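(* Let $D$ be a normalized $c$-ARS in a uniformly smooth Banach space $X$. Then there are constants $t>0$ and $\varepsilon<1$, depending solely on $c$ and on the modulus of smoothness of $X$, such that the set $\pm tD=\{td: d\in D\}\cup\{-td:d\in D\}$ is an $\varepsilon$-net of $B(X)$.
   Context: Banach spaces are real and nonzero; $B(X)$ is the closed unit ball of $X$. A set is normalized if all its elements have norm $1$. The modulus of smoothness of $X$ is $\rho(\tau)=\sup\{(\|x+y\|+\|x-y\|)/2-1 : x,y\in X,\ \|x\|=1,\ \|y\|\le\tau\}$ for $\tau>0$; $X$ is uniformly smooth if $\lim_{\tau\to0}\rho(\tau)/\tau=0$. A set $D\subset X$ is a $c$-ARS ($c$-absolutely representing system) in $X$ if every $x\in B(X)$ can be written as $x=\sum_{i=1}^\infty a_i x_i$ with scalars $a_i$, elements $x_i\in D$ (repetitions allowed), and $\sum_{i=1}^\infty\|a_i x_i\|\le c$. A set $A\subset X$ is an $\varepsilon$-net of a set $K\subset X$ if for every $x\in K$ there is $y\in A$ with $\|x-y\|\le\varepsilon$ ($A$ need not be contained in $K$). *)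

(* Defs.v *)
From HB Require Import structures.
From mathcomp Require Export all_boot all_order all_algebra.
From mathcomp Require Export all_classical all_reals all_analysis.

Set Implicit Arguments.
Unset Strict Implicit.
Unset Printing Implicit Defensive.

Import Order.TTheory GRing.Theory Num.Theory.
Import numFieldNormedType.Exports.

Local Open Scope classical_set_scope.
Local Open Scope ring_scope.

(* For X nonzero and tau > 0 the set is nonempty and bounded above by tau, so
   the default value of [sup] plays no role. *)
Definition modulus_of_smoothness (R : realType) (X : normedModType R)
    (tau : R) : R :=
  sup [set r : R | exists x y : X, [/\ `|x| = 1, `|y| <= tau &
    r = (`|x + y| + `|x - y|) / 2 - 1]].

Definition uniformly_smooth (R : realType) (X : normedModType R) : Prop :=
  (fun tau : R => modulus_of_smoothness X tau / tau) @ (0 : R)^'+ --> (0 : R).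

Definition normalized (R : realType) (X : normedModType R) (D : set X) : Prop :=
  forall x, D x -> `|x| = 1.

Definition is_ARS (R : realType) (X : normedModType R) (c : R) (D : set X) :
    Prop :=
  forall x, closed_ball (0 : X) 1 x ->
    exists (a : nat -> R) (d : nat -> X),
      [/\ forall i, D (d i),
          series (fun i => a i *: d i) @ \oo --> x &
          (\sum_(0 <= i <oo) (`|a i *: d i|)%:E <= c%:E)%E].

(* A need not be contained in K. *)
Definition is_net (R : realType) (X : normedModType R) (eps : R)
    (A K : set X) : Prop :=
  forall x, K x -> exists2 y, A y & `|x - y| <= eps.

Definition pm_dilate (R : realType) (X : normedModType R) (t : R) (D : set X) :
    set X :=
  [set t *: d | d in D] `|` [set - (t *: d) | d in D].

(* Main.v *)
Require Import Defs.
From mathcomp Require Import all_boot all_order all_algebra.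
From mathcomp Require Import all_classical all_reals all_analysis.
From mathcomp Require Import ring lra.

Set Implicit Arguments.
Unset Strict Implicit.
Unset Printing Implicit Defensive.

Import Order.TTheory GRing.Theory Num.Theory.
Import numFieldNormedType.Exports.

Local Open Scope classical_set_scope.
Local Open Scope ring_scope.

(** Let [u] be a unit vector and [u = \sum_i a_i d_i] with [\sum_i |a_i| <= C].
    Since [C u + t \sum_i a_i d_i] is the combination of [u] and the vectors
    [u + t (sg a_i) d_i] with nonnegative coefficients of total mass [C], some
    signed [e = (sg a_i) d_i] satisfies [|u + t e| >= 1 + t / (2 C)]; no norming
    functional is needed. By the definition of the modulus of smoothness,
    [|u - t e| <= 1 + 2 rho t - t / (2 C)], which is at most [1 - t / (4 C)] as
    soon as [rho t <= t / (8 C)]. A general point [x = s u] of the unit ball,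
    with [0 <= s <= 1], is handled by convexity of the norm. *)

Section SmoothSpace.
Context {R : realType} {X : normedModType R}.
Implicit Types (D : set X) (x y u : X) (c C t tau : R).

Lemma modulus_of_smoothness_ub x y tau : `|x| = 1 -> `|y| <= tau ->
  (`|x + y| + `|x - y|) / 2 - 1 <= modulus_of_smoothness X tau.
Proof.
move=> x1 ytau; apply: ub_le_sup; last by exists x, y.
(* By the triangle inequality [tau] bounds the set, so [sup] is a true supremum here. *)
exists tau => _ [x' [y' [x'1 y'tau ->]]].
have := ler_normD x' y'; have := ler_normB x' y'; rewrite x'1; lra.
Qed.

Lemma is_ARS_le c C D : c <= C -> is_ARS c D -> is_ARS C D.
Proof.
move=> cC ARS x /ARS[a [d [Dd ad_x ad_c]]]; exists a, d; split=> //.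
by apply: le_trans ad_c _; rewrite lee_fin.
Qed.

(** Truncating the series at a small error lets the averaging argument run on finite sums. *)
Lemma ARS_partial_sums C D u (eps : R) : 0 < eps -> normalized D ->
    is_ARS C D -> `|u| <= 1 ->
  exists (a : nat -> R) (d : nat -> X) (n : nat),
    [/\ forall i, D (d i), \sum_(i < n) `|a i| <= C &
        `|u - \sum_(i < n) a i *: d i| < eps].
Proof.
move=> eps0 D1 ARS u1.
have /ARS[a [d [Dd ad_u ad_C]]] : closed_ball 0 1 u.
  by rewrite closed_ballE// /closed_ball_ /= sub0r normrN.
move/cvgrPdist_lt : ad_u => /(_ _ eps0)[n _ /(_ n (leqnn n))].
rewrite /series /= big_mkord => ad_u.
exists a, d, n; split=> //.
rewrite -lee_fin; apply: le_trans ad_C.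
apply: le_trans (nneseries_lim_ge n _); last by [].
rewrite sumEFin lee_fin big_mkord ler_sum// => i _.
by rewrite normrZ (D1 _ (Dd i)) mulr1.
Qed.

Lemma ARS_direction C D u t : 0 < t -> 0 < C -> normalized D -> is_ARS C D ->
    `|u| = 1 ->
  exists2 e, D e \/ D (- e) & 1 + t / (2 * C) <= `|u + t *: e|.
Proof.
move=> t0 C0 D1 ARS u1; apply: contrapT => noe.
set K := 1 + t / (2 * C) in noe.
have K1 : 1 <= K by rewrite lerDl divr_ge0// ltW// mulr_gt0.
have small e : D e \/ D (- e) -> `|u + t *: e| <= K.
  by move=> De; rewrite leNgt; apply/negP => /ltW Ke; apply: noe; exists e.
(* Truncation error below 1/2 costs less than half of the gain [t]; the other half is
   [t / 2 = C * (K - 1)]. *)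
have half0 : 0 < 2^-1 :> R by rewrite invr_gt0.
have [|a [d [n [Dd aC ad_u]]]] := ARS_partial_sums half0 D1 ARS (u := u).
  by rewrite u1.
have term i : `| `|a i| *: u + t *: (a i *: d i)| <= `|a i| * K.
  have -> : `|a i| *: u + t *: (a i *: d i)
          = `|a i| *: (u + t *: (Num.sg (a i) *: d i)).
    rewrite scalerDr; congr (_ + _); rewrite !scalerA; congr (_ *: _).
    by rewrite {1}[a i]numEsg; ring.
  rewrite normrZ normr_id ler_wpM2l//.
  (* A zero coefficient gives no signed element of [D]; then [K1] suffices. *)
  case: sgrP => _; first by rewrite scale0r scaler0 addr0 u1.
    by rewrite scale1r; apply: small; left.
  by apply: small; rewrite scaleN1r; right; rewrite opprK.
set A := \sum_(i < n) `|a i| in aC.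
set S := \sum_(i < n) a i *: d i in ad_u.
have upper : `|C *: u + t *: S| <= C * K.
  have -> : C *: u + t *: S
          = (C - A) *: u + \sum_(i < n) (`|a i| *: u + t *: (a i *: d i)).
    by rewrite big_split/= -scaler_suml -scaler_sumr addrA -scalerDl subrK.
  apply: le_trans (ler_normD _ _) _.
  have -> : C * K = (C - A) * K + \sum_(i < n) `|a i| * K.
    by rewrite -mulr_suml -/A; ring.
  rewrite lerD//.
    by rewrite normrZ u1 ger0_norm ?subr_ge0// ler_wpM2l// subr_ge0.
  by apply: le_trans (ler_norm_sum _ _ _) _; apply: ler_sum.
(* Here [C u + t S = (C + t) u - t (u - S)]. *)
have lower : C + t <= `|C *: u + t *: S| + t * `|u - S|.
  have -> : C + t = `|(C + t) *: u|.
    by rewrite normrZ u1 mulr1 gtr0_norm// addr_gt0.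
  have -> : t * `|u - S| = `|t *: (u - S)| by rewrite normrZ gtr0_norm.
  apply: le_trans (ler_normD _ _).
  by rewrite scalerBr addrA addrAC addrK -scalerDl.
have CK : C * K = C + t / 2.
  by rewrite /K; field; rewrite gt_eqF.
have : t * `|u - S| < t * 2^-1 by rewrite ltr_pM2l.
lra.
Qed.

Lemma ARS_net C D t : 0 < t -> t <= 2^-1 -> 0 < C -> normalized D ->
    is_ARS C D -> modulus_of_smoothness X t <= t / (8 * C) ->
    (exists x, x != 0) ->
  is_net (Num.max (1 - t / (4 * C)) 2^-1) (pm_dilate t D) (closed_ball 0 1).
Proof.
move=> t0 t2 C0 D1 ARS rho_t [x0 x0_neq0] x.
rewrite closed_ballE// /closed_ball_ /= sub0r normrN => x1.
set eps := Num.max _ _.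
have [u u1 xu] : exists2 u, `|u| = 1 & x = `|x| *: u.
  have [->|x_neq0] := eqVneq x 0.
    exists (`|x0|^-1 *: x0); last by rewrite normr0 scale0r.
    by rewrite normrZ normfV normr_id mulVf// normr_eq0.
  exists (`|x|^-1 *: x); last by rewrite scalerA divff ?normr_eq0// scale1r.
  by rewrite normrZ normfV normr_id mulVf// normr_eq0.
have [e De ue] := ARS_direction t0 C0 D1 ARS u1.
have e1 : `|e| = 1 by case: De => /D1//; rewrite normrN.
have te : `|t *: e| = t by rewrite normrZ e1 mulr1 gtr0_norm.
exists (t *: e).
  by case: De => De; [left; exists e | right; exists (- e); rewrite ?scalerN ?opprK].
have ute : `|u - t *: e| <= eps.
  rewrite le_max; apply/orP; left.
  have := @modulus_of_smoothness_ub u (t *: e) t u1; rewrite te lexx => /(_ isT).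
  (* Put [q = t / (8 C)]: the norms of [u + t e] and [u - t e] sum to at most [2 + 2 q] and the
     first is at least [1 + 4 q], so the second is at most [1 - 2 q]. *)
  have -> : t / (4 * C) = 2 * (t / (8 * C)) by field; rewrite gt_eqF.
  have E : t / (2 * C) = 4 * (t / (8 * C)) by field; rewrite gt_eqF.
  move: ue rho_t; rewrite E; lra.
have te_eps : `|t *: e| <= eps by rewrite te le_max t2 orbT.
(* A convex combination of [u - t e] and [- t e] with weights [|x|] and [1 - |x|]; the second point,
   of norm [t <= 1/2], accounts for the 1/2 in [eps]. *)
have -> : x - t *: e = `|x| *: (u - t *: e) - (1 - `|x|) *: (t *: e).
  rewrite {1}xu scalerBr scalerBl scale1r opprB addrA.
  by rewrite -[X in X - _ = _](subrK (`|x| *: (t *: e))).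
apply: le_trans (ler_normB _ _) _.
rewrite !normrZ normr_id -normrZ (ger0_norm (x := 1 - _)) ?subr_ge0//.
have -> : eps = `|x| * eps + (1 - `|x|) * eps by ring.
by rewrite lerD// ler_wpM2l// subr_ge0.
Qed.

End SmoothSpace.

Lemma near0_le_linear (R : realType) (rho : R -> R) (k : R) : 0 < k ->
    (fun tau => rho tau / tau) @ 0^'+ --> (0 : R) ->
  exists t, [/\ 0 < t, t <= 2^-1 & rho t <= t * k].
Proof.
move=> k0 /cvgr0Pnorm_lt/(_ _ k0) rho_k.
near (0 : R)^'+ => t; have t0 : 0 < t by near: t; exact: nbhs_right_gt.
exists t; split => //.
  by near: t; apply: nbhs_right_le; rewrite invr_gt0.
rewrite mulrC -ler_pdivrMr//; apply: le_trans (ler_norm _) _.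
by apply: ltW; near: t.
Unshelve. all: by end_near. Qed.

(** Dependence on [c] and the modulus alone is expressed by choosing [t] and [eps] from [c] and
    [rho] before [X] and [D] are given. *)
Theorem corollary3p2 (R : realType) (c : R) (rho : R -> R) :
  exists t eps : R, [/\ 0 < t, eps < 1 &
    forall (X : completeNormedModType R) (D : set X),
      (exists x : X, x != 0) ->
      uniformly_smooth X ->
      (forall tau : R, 0 < tau -> modulus_of_smoothness X tau = rho tau) ->
      normalized D ->
      is_ARS c D ->
      is_net eps (pm_dilate t D) (closed_ball (0 : X) 1)].
Proof.
have [rho0|rhoN0] := pselect ((fun tau => rho tau / tau) @ 0^'+ --> (0 : R)).
  (* As [c] is an arbitrary real, the maximum secures a positive constant to divide by. *)
  set C := Num.max c 1.
  have C0 : 0 < C by rewrite lt_max ltr01 orbT.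
  have k0 : 0 < (8 * C)^-1 by rewrite invr_gt0 mulr_gt0.
  have [t [t0 t2 rho_t]] := near0_le_linear k0 rho0.
  exists t, (Num.max (1 - t / (4 * C)) 2^-1); split => //.
    rewrite gt_max; apply/andP; split; last lra.
    by rewrite ltrBlDr ltrDl divr_gt0// mulr_gt0.
  move=> X D X0 _ rhoE D1 ARS.
  apply: (@ARS_net _ X C) => //; last by rewrite rhoE.
  by apply: is_ARS_le ARS; rewrite le_max lexx.
(* [rho] is not the modulus of a uniformly smooth space: any [t], [eps] do. *)
exists 1, 0; split => // X D _ X_smooth rhoE.
exfalso; apply: rhoN0; apply: cvg_trans X_smooth.
apply: near_eq_cvg; near=> tau; rewrite rhoE//.
Unshelve. all: by end_near. Qed.
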